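(* Let $\mathsf{L}$ be one of classical predicate logic $\mathsf{CQC}$, intuitionistic predicate logic $\mathsf{IQC}$, or minimal predicate logic $\mathsf{MQC}$, and let $j$ be a nucleus relative to $\mathsf{L}$. Let $\varphi^j$ (Gödel-Gentzen-style translation), $J\varphi$ and $\varphi_j := j(J\varphi)$ (Kuroda-style translation) be as defined in the context. Then: (a) For every formula $\varphi$ we have $\vdash_{\mathsf{L}} \varphi^j \leftrightarrow \varphi_j$. (b) For all formulas $\varphi_1,\ldots,\varphi_n,\psi$: if $\varphi_1,\ldots,\varphi_n \vdash_{\mathsf{L}} \psi$, then $J(\varphi_1),\ldots,J(\varphi_n) \vdash_{\mathsf{L}} \psi_j$.
   Context: Logics. Formulas are formulas of predicate logic built with $\land,\lor,\to,\exists,\forall,\bot$ as primitives, where $\lnot\varphi$ abbreviates $\varphi\to\bot$ and $\varphi\leftrightarrow\psi$ abbreviates $(\varphi\to\psi)\land(\psi\to\varphi)$. $\mathsf{MQC}$ (minimal predicate logic) is axiomatised in natural deduction style by the standard introduction and elimination rules for $\land,\lor,\to,\exists,\forall$, with ''$\varphi$ follows from $\varphi$'' as the only axiom; in it $\bot$ has no special properties and acts as an arbitrary propositional constant. $\mathsf{IQC}$ is $\mathsf{MQC}$ plus ex falso $\bot\to\varphi$. $\mathsf{CQC}$ is $\mathsf{IQC}$ plus excluded middle $\varphi\lor\lnot\varphi$ (equivalently $\lnot\lnot\varphi\to\varphi$). $\varphi_1,\ldots,\varphi_n\vdash_{\mathsf{L}}\psi$ means that $\psi$ is derivable in $\mathsf{L}$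 from the assumptions $\varphi_1,\ldots,\varphi_n$ (formulas may have free variables). Nucleus. A function $j$ mapping formulas to formulas is a nucleus relative to $\mathsf{L}$ if for all formulas $\varphi,\psi$ (and all variables $x$ and terms $t$, with capture-avoiding substitution $[t/x]$): - $\vdash_{\mathsf{L}} \varphi\to j\varphi$; - $\vdash_{\mathsf{L}} j(\varphi\land\psi)\leftrightarrow(j\varphi\land j\psi)$; - $\vdash_{\mathsf{L}} (\varphi\to j\psi)\to(j\varphi\to j\psi)$; - $\vdash_{\mathsf{L}} (j\varphi)[t/x]\leftrightarrow j(\varphi[t/x])$. Gödel-Gentzen-style $j$-translation. $\varphi^j$ is defined by induction on $\varphi$: - $\varphi^j := j\varphi$ if $\varphi$ is atomic ($\bot$ counts as atomic); - $(\varphi\land\psi)^j := \varphi^j\land\psi^j$; - $(\varphi\lor\psi)^j := j(\varphi^j\lor\psi^j)$; - $(\varphi\to\psi)^j := \varphi^j\to\psi^j$; - $(\exists x\,\varphi)^j := j(\exists x\,\varphi^j)$; - $(\forall x\,\varphi)^j := \forall x\,\varphi^j$. Kuroda-style $j$-translation. $J\varphi$ is defined by induction on $\varphi$: - $J\varphi := \varphi$ if $\varphi$ is atomic ($\bot$ counts as atomic); - $J(\varphi\land\psi) := J\varphi\land J\psi$; - $J(\varphi\lor\psi) := J\varphi\lor J\psi$; - $J(\varphi\to\psi) := J\varphi\to j(J\psi)$; - $J(\exists x\,\varphi) := \exists x\,J\varphi$; - $J(\forall x\,\varphi) := \forall x\,j(J\varphi)$. Finally $\varphi_j := j(J\varphi)$.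 *)

(* Defs.v *)
From mathcomp Require Import all_boot.
From Stdlib Require List.

Set Implicit Arguments.
Unset Strict Implicit.
Unset Printing Implicit Defensive.

Record signature := Signature {
  funcs : Type;
  far : funcs -> nat;
  preds : Type;
  par : preds -> nat
}.

Section Syntax.
Variable S : signature.

Inductive term : Type :=
| Var of nat
| App (f : funcs S) of {ffun 'I_(far f) -> term}.

Inductive form : Type :=
| Bot
| Atom (p : preds S) of {ffun 'I_(par p) -> term}
| And of form & form
| Or of form & form
| Imp of form & form
| Ex of nat & form
| All of nat & form.

Definition Neg (A : form) : form := Imp A Bot.
Definition Iff (A B : form) : form := And (Imp A B) (Imp B A).

Fixpoint tfv (t : term) : seq nat :=
  match t with
  | Var x => [:: x]
  | App f a => flatten [seq tfv (a i) | i : 'I_(far f)]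
  end.

Fixpoint fv (A : form) : seq nat :=
  match A with
  | Bot => [::]
  | Atom p a => flatten [seq tfv (a i) | i : 'I_(par p)]
  | And B C | Or B C | Imp B C => fv B ++ fv C
  | Ex x B | All x B => [seq y <- fv B | y != x]
  end.

Fixpoint tsubst (sigma : nat -> term) (t : term) : term :=
  match t with
  | Var x => sigma x
  | App f a => App [ffun i => tsubst sigma (a i)]
  end.

Definition fresh (s : seq nat) : nat := (\max_(x <- s) x).+1.

(* A variable occurring in no term sigma y for y in s. *)
Definition fresh_for (sigma : nat -> term) (s : seq nat) : nat :=
  fresh (flatten [seq tfv (sigma y) | y <- s]).

Definition upd (sigma : nat -> term) (x : nat) (t : term) : nat -> term :=
  fun y => if y == x then t else sigma y.

(* Capture-avoiding simultaneous substitution.  Every bound variable is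
   renamed to a fresh one, whether or not a capture threatens: the result is
   the usual one up to the names of bound variables, and the recursion stays
   structural. *)
Fixpoint fsubst (sigma : nat -> term) (A : form) : form :=
  match A with
  | Bot => Bot
  | Atom p a => Atom [ffun i => tsubst sigma (a i)]
  | And B C => And (fsubst sigma B) (fsubst sigma C)
  | Or B C => Or (fsubst sigma B) (fsubst sigma C)
  | Imp B C => Imp (fsubst sigma B) (fsubst sigma C)
  | Ex x B => let z := fresh_for sigma (fv (Ex x B)) in
              Ex z (fsubst (upd sigma x (Var z)) B)
  | All x B => let z := fresh_for sigma (fv (All x B)) in
               All z (fsubst (upd sigma x (Var z)) B)
  end.

(* A[t/x] *)
Definition subst1 (A : form) (t : term) (x : nat) : form :=
  fsubst (upd Var x t) A.

End Syntax.

Arguments Var {S} _.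
Arguments Bot {S}.

Inductive logic := CQC | IQC | MQC.

(* nd L G A: there is a natural deduction of A in L all of whose open
   assumptions are listed in G.  Assumptions in G need not be used; because of
   nd_weak, the eigenvariable conditions of nd_AllI and nd_ExE only constrain
   the assumptions on which the relevant subderivation depends. *)
Inductive nd (S : signature) (L : logic) : seq (form S) -> form S -> Prop :=
| nd_ax G A : List.In A G -> nd L G A
| nd_weak G D A : List.incl G D -> nd L G A -> nd L D A
| nd_AndI G A B : nd L G A -> nd L G B -> nd L G (And A B)
| nd_AndE1 G A B : nd L G (And A B) -> nd L G A
| nd_AndE2 G A B : nd L G (And A B) -> nd L G B
| nd_OrI1 G A B : nd L G A -> nd L G (Or A B)
| nd_OrI2 G A B : nd L G B -> nd L G (Or A B)
| nd_OrE G A B C :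
    nd L G (Or A B) -> nd L (A :: G) C -> nd L (B :: G) C -> nd L G C
| nd_ImpI G A B : nd L (A :: G) B -> nd L G (Imp A B)
| nd_ImpE G A B : nd L G (Imp A B) -> nd L G A -> nd L G B
| nd_ExI G A x t : nd L G (subst1 A t x) -> nd L G (Ex x A)
| nd_ExE G A x C :
    nd L G (Ex x A) -> nd L (A :: G) C ->
    (forall B, List.In B G -> x \notin fv B) -> x \notin fv C ->
    nd L G C
| nd_AllI G A x :
    nd L G A -> (forall B, List.In B G -> x \notin fv B) -> nd L G (All x A)
| nd_AllE G A x t : nd L G (All x A) -> nd L G (subst1 A t x)
| nd_efq G A : L = IQC \/ L = CQC -> nd L G (Imp Bot A)
| nd_em G A : L = CQC -> nd L G (Or A (Neg A)).

Record nucleus (S : signature) (L : logic) (j : form S -> form S) : Prop := {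
  nucleus_unit : forall A, nd L [::] (Imp A (j A));
  nucleus_And : forall A B, nd L [::] (Iff (j (And A B)) (And (j A) (j B)));
  nucleus_bind : forall A B,
    nd L [::] (Imp (Imp A (j B)) (Imp (j A) (j B)));
  nucleus_subst : forall A x t,
    nd L [::] (Iff (subst1 (j A) t x) (j (subst1 A t x)))
}.

Section Translations.
Variables (S : signature) (j : form S -> form S).

(* The Goedel-Gentzen-style translation A^j. *)
Fixpoint gg (A : form S) : form S :=
  match A with
  | Bot | Atom _ _ => j A
  | And B C => And (gg B) (gg C)
  | Or B C => j (Or (gg B) (gg C))
  | Imp B C => Imp (gg B) (gg C)
  | Ex x B => j (Ex x (gg B))
  | All x B => All x (gg B)
  end.

(* J A, the inner part of the Kuroda-style translation A_j. *)
Fixpoint kuJ (A : form S) : form S :=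
  match A with
  | Bot | Atom _ _ => A
  | And B C => And (kuJ B) (kuJ C)
  | Or B C => Or (kuJ B) (kuJ C)
  | Imp B C => Imp (kuJ B) (j (kuJ C))
  | Ex x B => Ex x (kuJ B)
  | All x B => All x (j (kuJ B))
  end.

Definition kuroda (A : form S) : form S := j (kuJ A).

End Translations.

(* Main.v *)
(** By induction on A, the formula A^j is equivalent to A_j, since A_j obeys the
    clauses defining A^j up to equivalence; soundness of A_j is checked rule by
    rule.  The work lies in substitution: (J A)[t/x] must be equivalent to
    J (A[t/x]), and the eigenvariable conditions must survive although j may
    introduce new free variables.  The substitution axiom of a nucleus makes
    these inessential: if x is not free in A, then J A is equivalent to
    (J A)[z/x] for any z, so in an offending assumption x can be replaced by
    another variable. *)

Require Import Defs.
From mathcomp Require Import all_boot.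

Set Implicit Arguments.
Unset Strict Implicit.
Unset Printing Implicit Defensive.

(** * Simultaneous substitution: free variables, composition, reduction to single variables *)

Section Substitution.
Variable S : signature.
Implicit Types (t : term S) (A B C D : form S) (sigma tau rho : nat -> term S).

(** The arguments of [App] sit inside a finite function, so the induction hypothesis for them is
    obtained from a direct fixpoint. *)
Lemma term_nested_ind (P : term S -> Prop) :
  (forall x, P (Var x)) ->
  (forall f (a : {ffun 'I_(far f) -> term S}), (forall i, P (a i)) -> P (App a)) ->
  forall t, P t.
Proof.
move=> PV PA; fix IH 1; case=> [x|f a]; first exact: PV.
by apply: PA => i; apply: IH.
Qed.

Lemma eq_tsubst sigma tau t :
  {in tfv t, sigma =1 tau} -> tsubst sigma t = tsubst tau t.
Proof.
elim/term_nested_ind: t => [x|f a IH] /= eq_st; first by rewrite eq_st ?inE.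
congr App; apply/ffunP => i; rewrite !ffunE; apply: IH => y y_ai.
by apply/eq_st/flatten_imageP; exists i.
Qed.

Lemma tsubst_var t : tsubst Var t = t.
Proof.
elim/term_nested_ind: t => [x|f a IH] //=.
by congr App; apply/ffunP => i; rewrite ffunE.
Qed.

Lemma tsubst_comp sigma tau t :
  tsubst sigma (tsubst tau t) = tsubst (fun y => tsubst sigma (tau y)) t.
Proof.
elim/term_nested_ind: t => [x|f a IH] //=.
by congr App; apply/ffunP => i; rewrite !ffunE.
Qed.

Lemma tfv_tsubst sigma t y :
  reflect (exists2 w, w \in tfv t & y \in tfv (sigma w))
          (y \in tfv (tsubst sigma t)).
Proof.
apply: (iffP idP); elim/term_nested_ind: t => [x|f a IH] /=.
- by move=> y_sx; exists x; rewrite ?inE.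
- case/flatten_imageP=> i _; rewrite ffunE => /IH[w w_ai y_sw].
  by exists w => //; apply/flatten_imageP; exists i.
- by case=> w; rewrite inE => /eqP->.
- case=> w /flatten_imageP[i _ w_ai] y_sw; apply/flatten_imageP; exists i => //.
  by rewrite ffunE; apply: IH; exists w.
Qed.

Lemma fresh_notin (s : seq nat) : fresh s \notin s.
Proof.
apply/negP => fs; suff: fresh s <= \max_(x <- s) x by rewrite ltnn.
exact: (leq_bigmax_seq (P := predT) (F := id)).
Qed.

(** Maximum is idempotent, so order and repetitions do not influence the chosen name. This is what
    makes binder names agree on the nose in [fsubst_comp]. *)
Lemma eq_mem_fresh (s1 s2 : seq nat) : s1 =i s2 -> fresh s1 = fresh s2.
Proof. by move=> eq_s; congr _.+1; apply: eq_big_idem => //; apply: maxnn. Qed.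

Lemma fresh_for_notin sigma (s : seq nat) y :
  y \in s -> fresh_for sigma s \notin tfv (sigma y).
Proof.
move=> ys; apply: contra (fresh_notin (flatten [seq tfv (sigma w) | w <- s])).
by move=> fy; apply/flatten_mapP; exists y.
Qed.

Lemma eq_fresh_for sigma tau (s : seq nat) :
  {in s, sigma =1 tau} -> fresh_for sigma s = fresh_for tau s.
Proof.
by move=> eq_st; congr (fresh (flatten _)); apply/eq_in_map => y /eq_st->.
Qed.

Lemma upd_other sigma x t y : y != x -> upd sigma x t y = sigma y.
Proof. by rewrite /upd => /negPf->. Qed.

Lemma eq_upd sigma tau x t (s : seq nat) :
  {in [seq y <- s | y != x], sigma =1 tau} ->
  {in s, upd sigma x t =1 upd tau x t}.
Proof.
move=> eq_st y ys; rewrite /upd; case: eqVneq => // y'x.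
by apply: eq_st; rewrite mem_filter y'x.
Qed.

Lemma eq_fsubst sigma tau A :
  {in fv A, sigma =1 tau} -> fsubst sigma A = fsubst tau A.
Proof.
elim: A sigma tau => [|p a|B IHB C IHC|B IHB C IHC|B IHB C IHC|x B IH|x B IH]
  sigma tau //= eq_st.
- congr Atom; apply/ffunP => i; rewrite !ffunE; apply: eq_tsubst => y y_ai.
  by apply/eq_st/flatten_imageP; exists i.
- by rewrite (IHB _ tau) 1?(IHC _ tau) // => y y_in; apply: eq_st;
    rewrite mem_cat y_in ?orbT.
- by rewrite (IHB _ tau) 1?(IHC _ tau) // => y y_in; apply: eq_st;
    rewrite mem_cat y_in ?orbT.
- by rewrite (IHB _ tau) 1?(IHC _ tau) // => y y_in; apply: eq_st;
    rewrite mem_cat y_in ?orbT.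
- by rewrite (eq_fresh_for eq_st); congr Ex; apply/IH/eq_upd.
- by rewrite (eq_fresh_for eq_st); congr All; apply/IH/eq_upd.
Qed.

(** The binder step of [fv_fsubst]: since [z] occurs in no image of a variable other than [x],
    discarding [z] removes exactly the contribution of [x]. *)
Lemma mem_image_upd sigma x z y (s : seq nat) :
    (forall w, w \in s -> w != x -> z \notin tfv (sigma w)) ->
  (y != z /\ exists2 w, w \in s & y \in tfv (upd sigma x (Var z) w)) <->
  (exists2 w, w \in [seq w <- s | w != x] & y \in tfv (sigma w)).
Proof.
move=> z_fresh; split=> [[y'z [w ws]]|[w]].
  rewrite /upd; case: eqVneq => [_|w'x y_w]; first by rewrite inE (negPf y'z).
  by exists w; rewrite ?mem_filter ?w'x.
rewrite mem_filter => /andP[w'x ws] y_w; split.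
  by apply: contraTneq y_w => ->; apply: z_fresh.
by exists w; rewrite ?upd_other.
Qed.

Lemma fresh_for_filter sigma x (s : seq nat) :
  let z := fresh_for sigma [seq y <- s | y != x] in
  forall w, w \in s -> w != x -> z \notin tfv (sigma w).
Proof. by move=> z w ws w'x; apply: fresh_for_notin; rewrite mem_filter w'x. Qed.

Lemma fv_fsubst sigma A y :
  reflect (exists2 w, w \in fv A & y \in tfv (sigma w))
          (y \in fv (fsubst sigma A)).
Proof.
suff: y \in fv (fsubst sigma A) <->
      exists2 w, w \in fv A & y \in tfv (sigma w).
  by move=> eqv; apply: (iffP idP) => /eqv.
have cat_case rho s1 s2 r1 r2 :
    (y \in s1 <-> exists2 w, w \in r1 & y \in tfv (rho w)) ->
    (y \in s2 <-> exists2 w, w \in r2 & y \in tfv (rho w)) ->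
  (y \in s1 ++ s2) <-> exists2 w, w \in r1 ++ r2 & y \in tfv (rho w).
  move=> H1 H2; rewrite mem_cat; split=> [/orP[/H1|/H2] [w wr yw]|[w]].
  - by exists w; rewrite // mem_cat wr.
  - by exists w; rewrite // mem_cat wr orbT.
  - rewrite mem_cat => /orP[] wr yw; apply/orP.
      by left; apply/H1; exists w.
    by right; apply/H2; exists w.
elim: A sigma => [|p a|B IHB C IHC|B IHB C IHC|B IHB C IHC|x B IH|x B IH]
  sigma /=.
- by split=> // -[].
- split=> [/flatten_imageP[i _]|[w /flatten_imageP[i _ w_ai] y_w]].
    rewrite ffunE => /tfv_tsubst[w w_ai y_w]; exists w => //.
    by apply/flatten_imageP; exists i.
  apply/flatten_imageP; exists i => //; rewrite ffunE.
  by apply/tfv_tsubst; exists w.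
1-3: by apply: cat_case; [apply: IHB | apply: IHC].

- rewrite mem_filter -(mem_image_upd y (@fresh_for_filter sigma x (fv B))).
  by split=> [/andP[-> /IH]|[-> /IH]].
- rewrite mem_filter -(mem_image_upd y (@fresh_for_filter sigma x (fv B))).
  by split=> [/andP[-> /IH]|[-> /IH]].
Qed.

Lemma fresh_for_comp sigma tau (s r : seq nat) :
  (forall y, y \in r <-> exists2 w, w \in s & y \in tfv (tau w)) ->
  fresh_for sigma r = fresh_for (fun y => tsubst sigma (tau y)) s.
Proof.
move=> r_img; apply: eq_mem_fresh => y.
apply/flatten_mapP/flatten_mapP => [[w /r_img[v vs w_v] y_w]|[v vs]].
  by exists v => //; apply/tfv_tsubst; exists w.
by case/tfv_tsubst=> w w_v y_w; exists w => //; apply/r_img; exists v.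
Qed.

(* Stoughton's observation: as every binder gets a name depending only on the
   images of the free variables, substitutions compose up to equality, not
   merely up to renaming. *)
Lemma fsubst_comp sigma tau A :
  fsubst sigma (fsubst tau A) = fsubst (fun y => tsubst sigma (tau y)) A.
Proof.
(* The intermediate binder name [z1] leaves no trace: it enters only as the image of [x], and the
   outer substitution turns it into [z2]. *)
have body rho1 rho2 x B z1 z2 :
    (forall w, w \in fv B -> w != x -> z1 \notin tfv (rho2 w)) ->
  fsubst (fun y => tsubst (upd rho1 z1 (Var z2)) (upd rho2 x (Var z1) y)) B =
  fsubst (upd (fun y => tsubst rho1 (rho2 y)) x (Var z2)) B.
  move=> z1_fresh; apply: eq_fsubst => y y_B; rewrite /upd.
  case: eqVneq => [_|y'x] /=; first by rewrite eqxx.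
  apply: eq_tsubst => w w_y; case: eqVneq w_y => // -> w_y.
  by have := z1_fresh y y_B y'x; rewrite w_y.
elim: A sigma tau => [|p a|B IHB C IHC|B IHB C IHC|B IHB C IHC|x B IH|x B IH]
  sigma tau //=.
- by congr Atom; apply/ffunP => i; rewrite !ffunE tsubst_comp.
- by rewrite IHB IHC.
- by rewrite IHB IHC.
- by rewrite IHB IHC.
- rewrite IH body; last exact: fresh_for_filter.
  rewrite -(@fresh_for_comp sigma tau (fv (Ex x B))
             (fv (fsubst tau (Ex x B)))) // => y.
  by split=> /fv_fsubst.
- rewrite IH body; last exact: fresh_for_filter.
  rewrite -(@fresh_for_comp sigma tau (fv (All x B))
             (fv (fsubst tau (All x B)))) // => y.
  by split=> /fv_fsubst.
Qed.


(** The quantifier rules and the substitution axiom of a nucleus treat one variable at a time, while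
    [fsubst] is simultaneous. Composites of single substitutions, performed from the head of the
    list on, bridge the two. *)
Fixpoint successive (l : seq (nat * term S)) : nat -> term S :=
  if l is (x, t) :: l' then fun y => tsubst (successive l') (upd Var x t y)
  else Var.

Lemma successive_cat l1 l2 y :
  successive (l1 ++ l2) y = tsubst (successive l2) (successive l1 y).
Proof.
elim: l1 y => [|[x t] l1 IH] y //=; rewrite tsubst_comp.
by apply: eq_tsubst => w _; apply: IH.
Qed.

(* First move the variables of s out of the way, to s + N, then substitute for
   the latter. *)
Lemma successive_approx sigma (s : seq nat) :
  exists l, {in s, successive l =1 sigma}.
Proof.
(* [N] exceeds all variables of [s] and of their images, so the shifted variables collide with
   neither. *)
pose N := fresh (s ++ flatten [seq tfv (sigma y) | y <- s]).
have lt_N w : w \in s ++ flatten [seq tfv (sigma y) | y <- s] -> w < N.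
  by move=> ws; rewrite /N /fresh ltnS;
    apply: (leq_bigmax_seq (P := predT) (F := id)).
have s_lt_N y : y \in s -> y < N by move=> ys; rewrite lt_N // mem_cat ys.
have sigma_lt_N y w : y \in s -> w \in tfv (sigma y) -> w < N.
  move=> ys wy; rewrite lt_N // mem_cat; apply/orP; right.
  by apply/flatten_mapP; exists y.
have away r y : {subset r <= s} ->
    successive [seq (x, Var (N + x)) | x <- r] y =
    if y \in r then Var (N + y) else Var y.
  elim: r y => [|x r IH] y //= sub_r; rewrite /upd inE.
  have sub_r' : {subset r <= s} by move=> w wr; rewrite sub_r // inE wr orbT.
  case: eqVneq => [->|_] /=; rewrite IH //; case: ifP => // /sub_r' /s_lt_N.
  by rewrite ltnNge leq_addr.
(* The second round fixes variables below [N], so an image already inserted is not altered by the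
   later substitutions. *)
have low r w : w < N -> successive [seq (N + x, sigma x) | x <- r] w = Var w.
  elim: r => //= x r IH ltwN; rewrite upd_other /= ?IH //.
  by apply: contraTneq ltwN => ->; rewrite -leqNgt leq_addr.
have back r y : {subset r <= s} -> y \in r ->
    successive [seq (N + x, sigma x) | x <- r] (N + y) = sigma y.
  elim: r => //= x r IH sub_r; rewrite inE /upd eqn_add2l.
  case: eqVneq => [-> _|_ /=].
    rewrite -[RHS]tsubst_var; apply: eq_tsubst => w wx; apply: low.
    by apply: sigma_lt_N wx; apply: sub_r; rewrite inE eqxx.
  by apply: IH => w wr; rewrite sub_r // inE wr orbT.
exists ([seq (x, Var (N + x)) | x <- s] ++ [seq (N + x, sigma x) | x <- s]).
by move=> y ys; rewrite successive_cat away // ys /= back.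
Qed.

Lemma fsubst_successive_cons x t l A :
  fsubst (successive ((x, t) :: l)) A = fsubst (successive l) (subst1 A t x).
Proof. by rewrite fsubst_comp. Qed.

(** Allows [nd_ExI] and [nd_AllE] to be applied to a substituted quantified formula: the fresh
    binder name disappears on instantiation. *)
Lemma subst1_fsubst sigma x z t A :
    (forall w, w \in fv A -> w != x -> z \notin tfv (sigma w)) ->
  subst1 (fsubst (upd sigma x (Var z)) A) t z = fsubst (upd sigma x t) A.
Proof.
move=> z_fresh; rewrite /subst1 fsubst_comp; apply: eq_fsubst => y y_A.
rewrite /upd; case: eqVneq => [_|y'x] /=; first by rewrite eqxx.
rewrite -[RHS]tsubst_var; apply: eq_tsubst => w w_y.
by case: eqVneq w_y => // ->; rewrite (negPf (z_fresh _ y_A y'x)).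
Qed.

(** Supplies the eigenvariable condition when a binder [z2] chosen by a substitution is replaced by
    [z1]. *)
Lemma notin_bound sigma x z1 z2 A :
    (forall w, w \in fv A -> w != x -> z1 \notin tfv (sigma w)) ->
    (forall w, w \in fv A -> w != x -> z2 \notin tfv (sigma w)) ->
  z1 \notin [seq y <- fv (fsubst (upd sigma x (Var z2)) A) | y != z2].
Proof.
move=> z1_fresh z2_fresh; rewrite mem_filter; apply/negP => /andP[z12 /fv_fsubst in1].
have [w] := (mem_image_upd z1 z2_fresh).1 (conj z12 in1).
by rewrite mem_filter => /andP[w'x wA]; rewrite (negPf (z1_fresh w wA w'x)).
Qed.

End Substitution.

Ltac hyp := by apply: nd_ax => /=; tauto.

(** * Derived rules, provable equivalence, and closure under substitution *)

Section Deduction.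
Variables (S : signature) (L : logic).
Implicit Types (t : term S) (A B C D : form S) (G : seq (form S)).
Implicit Types (sigma tau rho : nat -> term S).

Lemma nd_cons G A B : nd L G B -> nd L (A :: G) B.
Proof. by apply: nd_weak => C; right. Qed.

Lemma nd_cuts G H A :
  (forall B, List.In B H -> nd L G B) -> nd L H A -> nd L G A.
Proof.
elim: H A => [|B H IH] A GH HA; first by apply: nd_weak HA => C [].
apply: (@nd_ImpE _ _ _ B); last by apply: GH; left.
by apply: IH; [move=> C HC; apply: GH; right | apply: nd_ImpI].
Qed.

Lemma nd_trans G A B : nd L [:: A] B -> nd L G A -> nd L G B.
Proof. by move=> AB GA; apply: nd_cuts AB => C [<-|[]]. Qed.

Definition equivalent A B := nd L [:: A] B /\ nd L [:: B] A.

Lemma equivalentP A B : nd L [::] (Iff A B) <-> equivalent A B.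
Proof.
split=> [AB|[AB BA]]; last by apply: nd_AndI; apply: nd_ImpI.
split; [apply: (@nd_ImpE _ _ _ A) | apply: (@nd_ImpE _ _ _ B)]; try hyp.
  by apply: nd_cons; apply: nd_AndE1 AB.
by apply: nd_cons; apply: nd_AndE2 AB.
Qed.

Lemma equivalent_refl A : equivalent A A.
Proof. by split; hyp. Qed.

Lemma equivalent_sym A B : equivalent A B -> equivalent B A.
Proof. by case. Qed.

Lemma equivalent_trans B A C :
  equivalent A B -> equivalent B C -> equivalent A C.
Proof.
by move=> [AB BA] [BC CB]; split; [apply: nd_trans BC AB|apply: nd_trans BA CB].
Qed.

Lemma equivalent_And A A' B B' :
  equivalent A A' -> equivalent B B' -> equivalent (And A B) (And A' B').
Proof.
move=> [A1 A2] [B1 B2].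
split; apply: nd_AndI; [apply: nd_trans A1 _ | apply: nd_trans B1 _
  | apply: nd_trans A2 _ | apply: nd_trans B2 _];
  [apply: nd_AndE1 | apply: nd_AndE2 | apply: nd_AndE1 | apply: nd_AndE2]; hyp.
Qed.

Lemma nd_Or_mono A A' B B' :
  nd L [:: A] A' -> nd L [:: B] B' -> nd L [:: Or A B] (Or A' B').
Proof.
move=> AA' BB'; apply: nd_OrE; first by hyp.
  by apply/nd_OrI1/(nd_trans AA'); hyp.
by apply/nd_OrI2/(nd_trans BB'); hyp.
Qed.

Lemma equivalent_Or A A' B B' :
  equivalent A A' -> equivalent B B' -> equivalent (Or A B) (Or A' B').
Proof. by move=> [A1 A2] [B1 B2]; split; apply: nd_Or_mono. Qed.

Lemma nd_Imp_mono A A' B B' :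
  nd L [:: A'] A -> nd L [:: B] B' -> nd L [:: Imp A B] (Imp A' B').
Proof.
move=> A'A BB'; apply/nd_ImpI/(nd_trans BB').
by apply: (@nd_ImpE _ _ _ A); [hyp | apply: nd_trans A'A _; hyp].
Qed.

Lemma equivalent_Imp A A' B B' :
  equivalent A A' -> equivalent B B' -> equivalent (Imp A B) (Imp A' B').
Proof. by move=> [A1 A2] [B1 B2]; split; apply: nd_Imp_mono. Qed.

(** Formulas are not identified up to bound names, so alpha-conversion has to be derived inside the
    logic. *)
Lemma nd_fsubst_Ex_rename sigma x A z1 z2 :
    (forall w, w \in fv A -> w != x -> z1 \notin tfv (sigma w)) ->
    (forall w, w \in fv A -> w != x -> z2 \notin tfv (sigma w)) ->
  nd L [:: Ex z1 (fsubst (upd sigma x (Var z1)) A)]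
    (Ex z2 (fsubst (upd sigma x (Var z2)) A)).
Proof.
move=> z1_fresh z2_fresh; apply: nd_ExE; first by hyp.
- by apply: (@nd_ExI _ _ _ _ _ (Var z1)); rewrite subst1_fsubst //; hyp.
- by move=> B [<-|[]] /=; rewrite mem_filter eqxx.
- exact: notin_bound.
Qed.

Lemma nd_fsubst_All_rename sigma x A z1 z2 :
    (forall w, w \in fv A -> w != x -> z1 \notin tfv (sigma w)) ->
    (forall w, w \in fv A -> w != x -> z2 \notin tfv (sigma w)) ->
  nd L [:: All z1 (fsubst (upd sigma x (Var z1)) A)]
    (All z2 (fsubst (upd sigma x (Var z2)) A)).
Proof.
move=> z1_fresh z2_fresh; apply: nd_AllI.
  by rewrite -[X in nd _ _ X](subst1_fsubst _ z1_fresh); apply: nd_AllE; hyp.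
by move=> B [<-|[]]; apply: notin_bound.
Qed.

Lemma notin_bound_self x A : x \notin [seq y <- fv A | y != x].
Proof. by rewrite mem_filter eqxx. Qed.

Lemma subst1_same A x : subst1 A (Var x) x = fsubst Var A.
Proof. by apply: eq_fsubst => y _; rewrite /upd; case: eqVneq => // ->. Qed.

(** Even the identity substitution renames every binder, so only provable equivalence, not equality,
    can be expected. *)
Lemma equivalent_fsubst_var A : equivalent A (fsubst Var A).
Proof.
elim: A => [|p a|B IHB C IHC|B IHB C IHC|B IHB C IHC|x B [IH1 IH2]|x B [IH1 IH2]] /=.
- exact: equivalent_refl.
- have <- : a = [ffun i => tsubst Var (a i)]; last exact: equivalent_refl.
  by apply/ffunP => i; rewrite ffunE tsubst_var.
- exact: equivalent_And.
- exact: equivalent_Or.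
- exact: equivalent_Imp.
- set z := fresh_for _ _.
  have z_fresh : forall w, w \in fv B -> w != x -> z \notin tfv (@Var S w).
    exact: fresh_for_filter.
  have x_fresh w : w \in fv B -> w != x -> x \notin tfv (@Var S w).
    by rewrite inE eq_sym.
  split; apply: nd_ExE; try (by hyp).
  + apply: (@nd_ExI _ _ _ _ _ (Var x)); rewrite subst1_fsubst //.
    by rewrite -/(subst1 B _ _) subst1_same; apply: nd_trans IH1 _; hyp.
  + by move=> C [<-|[]]; apply: notin_bound_self.
  + exact: notin_bound.
  + by apply: (@nd_ExI _ _ _ _ _ (Var z)); hyp.
  + by move=> C [<-|[]]; apply: notin_bound_self.
  + rewrite mem_filter; apply/negP => /andP[z'x zB].
    by have := z_fresh _ zB z'x; rewrite inE eqxx.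
- set z := fresh_for _ _.
  have z_fresh : forall w, w \in fv B -> w != x -> z \notin tfv (@Var S w).
    exact: fresh_for_filter.
  have x_fresh w : w \in fv B -> w != x -> x \notin tfv (@Var S w).
    by rewrite inE eq_sym.
  split; apply: nd_AllI.
  + by apply: nd_AllE; hyp.
  + move=> C [<-|[]]; rewrite mem_filter; apply/negP => /andP[z'x zB].
    by have := z_fresh _ zB z'x; rewrite inE eqxx.
  + apply: nd_trans IH2 _; rewrite -(subst1_same B x).
    by rewrite -[X in nd _ _ X](subst1_fsubst _ z_fresh); apply: nd_AllE; hyp.
  + by move=> C [<-|[]]; apply: notin_bound.
Qed.

Lemma nd_subst1 A x t : nd L [::] A -> nd L [::] (subst1 A t x).
Proof. by move=> pA; apply: nd_AllE; apply: nd_AllI. Qed.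

(** A single variable is handled by generalising and instantiating, which is unrestricted without
    assumptions. This is iterated along a list that agrees with [sigma] on the free variables of
    [A]. *)
Lemma nd_fsubst sigma A : nd L [::] A -> nd L [::] (fsubst sigma A).
Proof.
have [l eq_l] := successive_approx sigma (fv A).
rewrite -(eq_fsubst eq_l) => {eq_l}; elim: l A => [|[x t] l IH] A pA.
  by apply: nd_trans pA; case: (equivalent_fsubst_var A).
by rewrite fsubst_successive_cons; apply/IH/nd_subst1.
Qed.

Lemma equivalent_fsubst sigma A B :
  equivalent A B -> equivalent (fsubst sigma A) (fsubst sigma B).
Proof. by move/equivalentP/(nd_fsubst sigma)/equivalentP. Qed.

Lemma nd_Ex_intro G x A : nd L G A -> nd L G (Ex x A).
Proof.
move=> GA; apply: (@nd_ExI _ _ _ _ _ (Var x)); rewrite subst1_same.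
by apply: nd_trans GA; case: (equivalent_fsubst_var A).
Qed.

Lemma nd_Ex_mono x A B : nd L [:: A] B -> nd L [:: Ex x A] (Ex x B).
Proof.
move=> AB; apply: nd_ExE; first by hyp.
- by apply/nd_Ex_intro/(nd_trans AB); hyp.
- by move=> C [<-|[]]; apply: notin_bound_self.
- exact: notin_bound_self.
Qed.

Lemma nd_All_elim G x A : nd L G (All x A) -> nd L G A.
Proof.
move/(nd_AllE (Var x)); rewrite subst1_same.
by apply: nd_trans; case: (equivalent_fsubst_var A).
Qed.

Lemma nd_All_mono x A B : nd L [:: A] B -> nd L [:: All x A] (All x B).
Proof.
move=> AB; apply: nd_AllI; last by move=> C [<-|[]]; apply: notin_bound_self.
by apply: nd_trans AB _; apply: (@nd_All_elim _ x); hyp.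
Qed.

Lemma equivalent_Ex x A B : equivalent A B -> equivalent (Ex x A) (Ex x B).
Proof. by move=> [AB BA]; split; apply: nd_Ex_mono. Qed.

Lemma equivalent_All x A B : equivalent A B -> equivalent (All x A) (All x B).
Proof. by move=> [AB BA]; split; apply: nd_All_mono. Qed.

End Deduction.

(** * Inessential free variables and relaxed eigenvariable conditions *)

Section Inert.
Variables (S : signature) (L : logic).
Implicit Types (t : term S) (A B C D : form S) (G : seq (form S)).
Implicit Types (sigma tau rho : nat -> term S).

Local Notation "A =||= B" := (equivalent L A B) (at level 70).

(* A nucleus may introduce free variables, but only inessential ones; these
   two notions replace, up to provable equivalence, the condition that the free
   variables of D are in s, respectively that x is not free in D. *)
Definition depends_on (s : seq nat) D :=
  forall sigma tau, {in s, sigma =1 tau} -> fsubst sigma D =||= fsubst tau D.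

Definition inert x D := forall t, D =||= subst1 D t x.

Lemma depends_on_inert (s : seq nat) x D :
  depends_on s D -> x \notin s -> inert x D.
Proof.
move=> D_s x_s t; apply: equivalent_trans (equivalent_fsubst_var L D) _.
apply: D_s => y ys; rewrite upd_other //.
by apply: contraNneq x_s => <-.
Qed.

Lemma notin_inert x A : x \notin fv A -> inert x A.
Proof.
apply: depends_on_inert => sigma tau /eq_fsubst->.
exact: equivalent_refl.
Qed.

Lemma notin_subst1_var A x z : x != z -> x \notin fv (subst1 A (Var z) x).
Proof.
move=> x'z; apply/fv_fsubst => -[w _]; rewrite /upd.
by case: eqVneq => [_|w'x]; rewrite inE ?(negPf x'z) // eq_sym (negPf w'x).
Qed.

(** Each assumption is equivalent to its instance. When [t] is a variable other than [x], the new
    context meets the literal eigenvariable condition for [x]. *)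
Lemma nd_context_subst1 G A x t :
    (forall B, List.In B G -> inert x B) ->
  nd L G A <-> nd L [seq subst1 B t x | B <- G] A.
Proof.
move=> G_inert; split; apply: nd_cuts => B.
  move=> BG; have [_ /nd_trans] := G_inert B BG t; apply; apply: nd_ax.
  by apply: List.in_map BG.
move=> /List.in_map_iff[C [<- CG]]; have [CC _] := G_inert C CG t.
by apply/(nd_trans CC)/nd_ax.
Qed.

Lemma nd_AllI_inert G A x :
  nd L G A -> (forall B, List.In B G -> inert x B) -> nd L G (All x A).
Proof.
(* [x.+1] is merely some variable other than [x]; it may well occur in [G]. *)
move=> GA G_inert; apply/(nd_context_subst1 _ (Var x.+1) G_inert).
apply: nd_AllI; first exact/(nd_context_subst1 _ (Var x.+1) G_inert).
move=> B /List.in_map_iff[C [<- _]]; apply: notin_subst1_var.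
by rewrite neq_ltn ltnSn.
Qed.

Lemma nd_ExE_inert G A x C :
    nd L G (Ex x A) -> nd L (A :: G) C ->
    (forall B, List.In B G -> inert x B) -> inert x C ->
  nd L G C.
Proof.
move=> GA AC G_inert C_inert; have [CC' C'C] := C_inert (Var x.+1).
have x'z : x != x.+1 by rewrite neq_ltn ltnSn.
apply: nd_trans C'C _; apply/(nd_context_subst1 _ (Var x.+1) G_inert).
apply: nd_ExE (notin_subst1_var _ x'z).
- by apply/(nd_context_subst1 _ (Var x.+1) G_inert); apply: GA.
(* [A] is discharged before the context is exchanged, since [x] need not be inert in [A]. *)
- apply/nd_ImpE/nd_ax; last by left.
  apply: nd_cons; apply/(nd_context_subst1 _ (Var x.+1) G_inert).
  by apply/nd_ImpI/(nd_trans CC').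
- by move=> B /List.in_map_iff[D [<- _]]; apply: notin_subst1_var.
Qed.

(* The name chosen for the binder in [fsubst sigma (Q x D)] depends on all of
   [fv D]; it may be replaced by one avoiding only the essential variables. *)
Lemma depends_on_rename (Q : nat -> form S -> form S) (s : seq nat) sigma x z D :
    (forall y A B, A =||= B -> Q y A =||= Q y B) ->
    (forall tau z1 z2,
      (forall w, w \in fv D -> w != x -> z1 \notin tfv (tau w)) ->
      (forall w, w \in fv D -> w != x -> z2 \notin tfv (tau w)) ->
      Q z1 (fsubst (upd tau x (Var z1)) D) =||=
      Q z2 (fsubst (upd tau x (Var z2)) D)) ->
    depends_on s D ->
    (forall w, w \in s -> w != x -> z \notin tfv (sigma w)) ->
  let z' := fresh_for sigma [seq y <- fv D | y != x] in
  Q z' (fsubst (upd sigma x (Var z')) D) =||= Q z (fsubst (upd sigma x (Var z)) D).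
Proof.
move=> Q_congr Q_rename D_s z_fresh z'.
(* [tau] acts on [D] like [sigma] up to equivalence, but its values outside [s] avoid [z]; thus [z]
   is fresh for [tau] on all of [fv D]. *)
pose tau y := if y \in s then sigma y else Var z.+1.
have eq_st u : fsubst (upd sigma x (Var u)) D =||= fsubst (upd tau x (Var u)) D.
  by apply: D_s => y ys; rewrite /upd /tau ys.
have z_tau w : w \in fv D -> w != x -> z \notin tfv (tau w).
  rewrite /tau; case: ifP => [ws _|_ _ _]; first exact: z_fresh.
  by rewrite inE neq_ltn ltnSn.
(* The name [u] is fresh for both substitutions: rename [z'] to [u] under [sigma], pass to [tau],
   rename [u] to [z], and return to [sigma]. *)
pose u := fresh (flatten [seq tfv (sigma w) ++ tfv (tau w) | w <- fv D]).
have u_fresh w : w \in fv D -> u \notin tfv (sigma w) ++ tfv (tau w).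
  move=> wD; rewrite /u; set r := flatten _; apply: contra (fresh_notin r) => uw.
  by apply/flatten_mapP; exists w.
apply: equivalent_trans (Q_rename sigma z' u _ _) _.
- exact: fresh_for_filter.
- by move=> w /u_fresh; rewrite mem_cat negb_or => /andP[].
apply: equivalent_trans (Q_congr _ _ _ (eq_st u)) _.
apply: equivalent_trans (Q_rename tau u z _ z_tau) _.
  by move=> w /u_fresh; rewrite mem_cat negb_or => /andP[].
exact/Q_congr/equivalent_sym/eq_st.
Qed.

End Inert.

(** * Nuclei and the Kuroda-style translation under substitution *)

Section Nucleus.
Variables (S : signature) (L : logic) (j : form S -> form S).
Hypothesis hj : nucleus L j.
Implicit Types (t : term S) (A B C D : form S) (G : seq (form S)).
Implicit Types (sigma tau rho : nat -> term S).

Local Notation "A =||= B" := (equivalent L A B) (at level 70).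

Lemma nucleus_intro G A : nd L G A -> nd L G (j A).
Proof.
apply: nd_trans; apply: nd_ImpE; last by hyp.
by apply: nd_cons; apply: nucleus_unit hj A.
Qed.

Lemma nucleus_elim G A B : nd L G (j A) -> nd L (A :: G) (j B) -> nd L G (j B).
Proof.
move=> GA /nd_ImpI AB; apply: nd_ImpE GA; apply: nd_ImpE AB.
by apply: nd_cuts (nucleus_bind hj A B).
Qed.

Lemma nucleus_lift A B : nd L [:: A] (j B) -> nd L [:: j A] (j B).
Proof.
move=> AB; apply: (@nucleus_elim _ A); first by hyp.
by apply: nd_trans AB _; hyp.
Qed.

Lemma nucleus_mono A B : nd L [:: A] B -> nd L [:: j A] (j B).
Proof.
by move/nucleus_intro/nucleus_lift.
Qed.

Lemma equivalent_nucleus A B : A =||= B -> j A =||= j B.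
Proof. by move=> [AB BA]; split; apply: nucleus_mono. Qed.

Lemma equivalent_nucleus_And A B : j (And A B) =||= And (j A) (j B).
Proof. exact/equivalentP/(nucleus_And hj). Qed.

(** Iterates the one-variable axiom. As [j A] may have free variables that [A] lacks, the list of
    single substitutions must agree with [sigma] on those of both formulas. *)
Lemma nucleus_fsubst sigma A : fsubst sigma (j A) =||= j (fsubst sigma A).
Proof.
have [l eq_l] := successive_approx sigma (fv A ++ fv (j A)).
rewrite -(@eq_fsubst _ (successive l) sigma (j A)); last first.
  by move=> y y_jA; apply: eq_l; rewrite mem_cat y_jA orbT.
rewrite -(@eq_fsubst _ (successive l) sigma A); last first.
  by move=> y y_A; apply: eq_l; rewrite mem_cat y_A.
elim: l A {sigma eq_l} => [|[x t] l IH] A.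
  apply: equivalent_trans (equivalent_sym (equivalent_fsubst_var L (j A))) _.
  exact/equivalent_nucleus/equivalent_fsubst_var.
rewrite !fsubst_successive_cons; apply: equivalent_trans (IH _).
exact/equivalent_fsubst/equivalentP/(nucleus_subst hj).
Qed.

Lemma nucleus_depends_on (s : seq nat) D :
  depends_on L s D -> depends_on L s (j D).
Proof.
move=> D_s sigma tau eq_st; apply: equivalent_trans (nucleus_fsubst _ _) _.
apply: equivalent_trans (equivalent_sym (nucleus_fsubst _ _)).
exact/equivalent_nucleus/D_s.
Qed.

Lemma nucleus_inert x D : inert L x D -> inert L x (j D).
Proof.
move=> D_inert t; apply: equivalent_trans (equivalent_sym (nucleus_fsubst _ _)).
exact/equivalent_nucleus/D_inert.
Qed.

(** Commutation with substitution is a hypothesis here so that the lemma can serve inside the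
    induction proving [kuJ_fsubst]. *)
Lemma kuJ_fsubst_depends_on A :
    (forall sigma, fsubst sigma (kuJ j A) =||= kuJ j (fsubst sigma A)) ->
  depends_on L (fv A) (kuJ j A).
Proof.
move=> A_subst sigma tau /eq_fsubst eq_st.
apply: equivalent_trans (A_subst _) _; rewrite eq_st.
exact/equivalent_sym/A_subst.
Qed.

(** At a quantifier the two sides draw their binder names from different lists of free variables,
    one of the translated body and one of [B]. By induction the translated body depends only on
    [fv B], so [depends_on_rename] reconciles the names. *)
Lemma kuJ_fsubst sigma A : fsubst sigma (kuJ j A) =||= kuJ j (fsubst sigma A).
Proof.
elim: A sigma => [|p a|B IHB C IHC|B IHB C IHC|B IHB C IHC|x B IH|x B IH] sigma /=.
- exact: equivalent_refl.
- exact: equivalent_refl.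
- exact: equivalent_And.
- exact: equivalent_Or.
- apply: equivalent_Imp => //; apply: equivalent_trans (nucleus_fsubst _ _) _.
  exact: equivalent_nucleus.
- apply: equivalent_trans (equivalent_Ex _ (IH _)).
  apply: (depends_on_rename (Q := @Ex S) (s := fv B)).
  + exact: equivalent_Ex.
  + by move=> tau z1 z2 *; split; apply: nd_fsubst_Ex_rename.
  + exact: kuJ_fsubst_depends_on.
  + exact: fresh_for_filter.
(* First the binder name is changed; then the substitution is moved through [j]. *)
- apply: (@equivalent_trans _ _ (All (fresh_for sigma [seq y <- fv B | y != x])
    (fsubst (upd sigma x (Var (fresh_for sigma [seq y <- fv B | y != x])))
       (j (kuJ j B))))).
    apply: (depends_on_rename (Q := @All S) (s := fv B)).
    + exact: equivalent_All.
    + by move=> tau z1 z2 *; split; apply: nd_fsubst_All_rename.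
    + exact/nucleus_depends_on/kuJ_fsubst_depends_on.
    + exact: fresh_for_filter.
  apply: equivalent_All; apply: equivalent_trans (nucleus_fsubst _ _) _.
  exact/equivalent_nucleus/IH.
Qed.

Lemma kuJ_inert x A : x \notin fv A -> inert L x (kuJ j A).
Proof.
move=> x_A; apply: depends_on_inert x_A.
by apply: kuJ_fsubst_depends_on => sigma; apply: kuJ_fsubst.
Qed.

Lemma kuroda_inert x A : x \notin fv A -> inert L x (kuroda j A).
Proof. by move=> /kuJ_inert/nucleus_inert. Qed.

Lemma kuroda_subst1 A t x : subst1 (kuroda j A) t x =||= kuroda j (subst1 A t x).
Proof.
apply: equivalent_trans (nucleus_fsubst _ _) _.
exact/equivalent_nucleus/kuJ_fsubst.
Qed.

(** * Comparison of the two translations, and soundness *)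

Lemma kuroda_mp G A B :
  nd L G (kuroda j (Imp A B)) -> nd L G (kuroda j A) -> nd L G (kuroda j B).
Proof.
move=> GAB GA; apply: (nucleus_elim GA); apply: (nucleus_elim (nd_cons _ GAB)).
by apply: (@nd_ImpE _ _ _ (kuJ j A)); hyp.
Qed.

Lemma kuroda_Or A B : kuroda j (Or A B) =||= j (Or (kuroda j A) (kuroda j B)).
Proof.
split.
  by apply/nucleus_mono/nd_Or_mono; apply: nucleus_intro; hyp.
apply: nucleus_lift; apply: nd_OrE; first by hyp.
  apply: (@nucleus_elim _ (kuJ j A)); first by hyp.
  by apply/nucleus_intro/nd_OrI1; hyp.
apply: (@nucleus_elim _ (kuJ j B)); first by hyp.
by apply/nucleus_intro/nd_OrI2; hyp.
Qed.

Lemma kuroda_Imp A B : kuroda j (Imp A B) =||= Imp (kuroda j A) (kuroda j B).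
Proof.
split.
  by apply: nd_ImpI; apply: (@kuroda_mp _ A); hyp.
apply/nucleus_intro/nd_ImpI; apply: nd_ImpE; first by hyp.
by apply: nucleus_intro; hyp.
Qed.

Lemma kuroda_Ex x A : kuroda j (Ex x A) =||= j (Ex x (kuroda j A)).
Proof.
split; first by apply/nucleus_mono/nd_Ex_mono/nucleus_intro; hyp.
(* The conclusion [j (Ex x (kuJ j A))] may literally contain [x], because [j] can add variables; it
   is only inert in [x]. *)
apply: nucleus_lift; apply: (nd_ExE_inert (A := kuroda j A) (x := x)).
- by hyp.
- apply: (@nucleus_elim _ (kuJ j A)); first by hyp.
  by apply/nucleus_intro/(nd_Ex_intro x); hyp.
- by move=> B [<-|[]]; apply/notin_inert/notin_bound_self.
- by apply/kuroda_inert/notin_bound_self.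
Qed.

(** As [kuJ j (All x A)] is by definition [All x (kuroda j A)], one direction is the unit of [j].
    Conversely, the instance at [x] is already under [j], so the outer [j] is absorbed, and [x] is
    inert in the assumption. *)
Lemma kuroda_All x A : kuroda j (All x A) =||= All x (kuroda j A).
Proof.
split; last by apply: nucleus_intro; hyp.
apply: nd_AllI_inert; first by apply/nucleus_lift/(@nd_All_elim _ _ _ x); hyp.
by move=> B [<-|[]]; apply/kuroda_inert/notin_bound_self.
Qed.

Lemma gg_kuroda A : gg j A =||= kuroda j A.
Proof.
elim: A => [|p a|B IHB C IHC|B IHB C IHC|B IHB C IHC|x B IH|x B IH] /=.
- exact: equivalent_refl.
- exact: equivalent_refl.
- apply: equivalent_trans (equivalent_And IHB IHC) _.
  exact/equivalent_sym/equivalent_nucleus_And.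
- apply: equivalent_trans (equivalent_sym (kuroda_Or B C)).
  exact/equivalent_nucleus/equivalent_Or.
- apply: equivalent_trans (equivalent_sym (kuroda_Imp B C)).
  exact: equivalent_Imp.
- apply: equivalent_trans (equivalent_sym (kuroda_Ex x B)).
  exact/equivalent_nucleus/equivalent_Ex.
- apply: equivalent_trans (equivalent_sym (kuroda_All x B)).
  exact: equivalent_All.
Qed.

(** Induction on the derivation. In most cases a premise is freed of its [j] because the goal is
    itself under [j], and the original rule is then applied to inner translations. Eigenvariable
    conditions on [G] survive as inertness of the translated context. *)
Lemma kuroda_sound G B : nd L G B -> nd L [seq kuJ j A | A <- G] (kuroda j B).
Proof.
have kuJ_context G' x : (forall C, List.In C G' -> x \notin fv C) ->
    forall C, List.In C [seq kuJ j A | A <- G'] -> inert L x C.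
  by move=> xG' C /List.in_map_iff[D [<- DG']]; apply/kuJ_inert/xG'.
elim=> {G B} [G A AG|G D A GD _ IH|G A B _ IHA _ IHB|G A B _ IH|G A B _ IH
  |G A B _ IH|G A B _ IH|G A B C _ IHAB _ IHA _ IHB|G A B _ IH|G A B _ IHAB _ IHA
  |G A x t _ IH|G A x C _ IHA _ IHC xG xC|G A x _ IH xG|G A x t _ IH|G A LA|G A LA].
- by apply/nucleus_intro/nd_ax/List.in_map.
- by apply: nd_weak IH; apply: List.incl_map.
- have [_ /nd_trans] := equivalent_nucleus_And (kuJ j A) (kuJ j B).
  by apply; apply: nd_AndI.
- apply: nd_trans IH; apply: nucleus_mono; apply: nd_AndE1; hyp.
- apply: nd_trans IH; apply: nucleus_mono; apply: nd_AndE2; hyp.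
- apply: nd_trans IH; apply: nucleus_mono; apply: nd_OrI1; hyp.
- apply: nd_trans IH; apply: nucleus_mono; apply: nd_OrI2; hyp.
- apply: (nucleus_elim IHAB); apply: (@nd_OrE _ _ _ (kuJ j A) (kuJ j B)).
  + by hyp.
  + by apply: nd_weak IHA => D /=; tauto.
  + by apply: nd_weak IHB => D /=; tauto.
- exact/nucleus_intro/nd_ImpI.
- exact: kuroda_mp IHAB IHA.
- apply: (nucleus_elim IH); apply/nucleus_intro/(@nd_ExI _ _ _ _ _ t).
  by have [_ /nd_trans] := kuJ_fsubst (upd Var x t) A; apply; hyp.
- apply: (nucleus_elim IHA).
  apply: (nd_ExE_inert (A := kuJ j A) (x := x)); first by hyp.
  + by apply: nd_weak IHC => D /=; tauto.
  + move=> B [<-|]; last exact: kuJ_context.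
    exact/notin_inert/notin_bound_self.
  + exact: kuroda_inert.
- by apply/nucleus_intro/nd_AllI_inert => //; apply: kuJ_context.
- have [KA _] := kuroda_All x A; have [KS _] := kuroda_subst1 A t x.
  by apply/(nd_trans KS)/nd_AllE/(nd_trans KA).
(* [kuJ j (Imp Bot A)] is [Imp Bot (j (kuJ j A))], again an instance of ex falso. *)
- exact/nucleus_intro/nd_efq.
(* The translated negation is [Imp (kuJ j A) (j Bot)], which follows from [Neg (kuJ j A)] by the
   unit at [Bot]. *)
- apply: nucleus_intro; apply: nd_trans (nd_em _ (kuJ j A) LA).
  apply: nd_Or_mono; first by hyp.
  by apply: nd_Imp_mono; [hyp | apply: nucleus_intro; hyp].
Qed.

End Nucleus.

Theorem proposition4p2 (S : signature) (L : logic) (j : form S -> form S)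
    (hj : nucleus L j) :
  (forall A : form S, nd L [::] (Iff (gg j A) (kuroda j A))) /\
  (forall (G : seq (form S)) (B : form S),
     nd L G B -> nd L [seq kuJ j A | A <- G] (kuroda j B)).
Proof.
split=> [A|G B]; last exact: kuroda_sound.
exact/equivalentP/gg_kuroda.
Qed.
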